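(* Let $a$ be an odd positive integer and $b$ an even positive integer with $a<b$. The subtraction game $\mathcal{S}(1,a,b)$ is periodic with period $a+b$ and nim-sequence $(01)^{b/2}(23)^{(a-1)/2}2$. Moreover, the subtraction set has expansion $\big(\{1,3,\ldots,a\}\cup\{b,b+2,\ldots,b+a-1\}\big)^{*(a+b)}$.
   Context: For a finite set $S$ of positive integers, the subtraction game $\mathcal{S}(S)$ is played on a single pile: two players alternately remove $s\in S$ coins (at most the pile size); the last mover wins. The nim-value is $\mathcal{G}(n)=\operatorname{mex}\{\mathcal{G}(n-s): s\in S, s\le n\}$. Words of single digits are written by juxtaposition, and $x^m$ denotes $m$-fold repetition of the block $x$ ($x^0$ is empty). ''The game is periodic with period $p$ and nim-sequence $W$'' ($W$ a word of length $p$) means $\mathcal{G}(n+p)=\mathcal{G}(n)$ for all $n\ge0$, $p$ is the least such, and $\mathcal{G}(n)$ is the $((n\bmod p)+1)$-st letter of $W$ for all $n\ge0$. The expansion of $S$ is $S^{ex}=\{s\ge1:\mathcal{G}(n+s)\ne\mathcal{G}(n)\ \forall n\ge0\}$; ''has expansion $T$'' means $S^{ex}=T$. For a set $X$ and $p\ge1$, $X^{*p}=\{x+mp:x\in X,m\ge0\}$. *)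

(* Defs.v *)
From mathcomp Require Import all_boot.
From mathcomp Require Import finmap classical_sets.

Set Implicit Arguments.
Unset Strict Implicit.
Unset Printing Implicit Defensive.

Local Open Scope fset_scope.
Local Open Scope nat_scope.

Lemma mex_exists (A : {fset nat}) : exists k, k \notin A.
Proof.
exists (\max_(i <- A) i).+1; apply/negP => kA.
by have := @leq_bigmax_seq _ (enum_fset A) predT id _ kA isT; rewrite ltnn.
Qed.

Definition mex (A : {fset nat}) : nat := ex_minn (mex_exists A).

(* The first argument is recursion fuel; [n.+1] is enough for a pile of [n]
   coins, see [nim_valueE].  A spurious 0 in [S] is not a legal move. *)
Fixpoint nim_value_rec (fuel : nat) (S : {fset nat}) (n : nat) : nat :=
  if fuel is k.+1 then
    mex [fset nim_value_rec k S (n - s) | s in S & 0 < s <= n]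
  else 0.

Definition nim_value (S : {fset nat}) (n : nat) : nat :=
  nim_value_rec n.+1 S n.

Lemma nim_value_rec_fuel k (S : {fset nat}) n :
  n < k -> nim_value_rec k S n = nim_value S n.
Proof.
suff fuelE l m : m < k -> m < l -> nim_value_rec k S m = nim_value_rec l S m.
  by move=> nk; apply: fuelE.
elim: k l m => [//|k IH] [//|l] m mk ml /=.
congr mex; apply: eq_in_imfset => //= s /andP[_ /andP[s0 sm]].
have lt_ms : m - s < m by rewrite ltn_subrL s0 (leq_trans s0 sm).
by apply: IH; apply: leq_trans lt_ms _.
Qed.

Lemma nim_valueE (S : {fset nat}) n :
  nim_value S n = mex [fset nim_value S (n - s) | s in S & 0 < s <= n].
Proof.
rewrite {1}/nim_value /=; congr mex; apply: eq_in_imfset => //= s /andP[_ /andP[s0 sn]].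
by apply: nim_value_rec_fuel; rewrite ltn_subrL s0 (leq_trans s0 sn).
Qed.

Definition word_pow (x : seq nat) (m : nat) : seq nat := flatten (nseq m x).

Definition is_period (S : {fset nat}) (p : nat) : Prop :=
  0 < p /\ forall n, nim_value S (n + p) = nim_value S n.

Definition periodic_with (S : {fset nat}) (p : nat) (W : seq nat) : Prop :=
  [/\ is_period S p,
      forall q, is_period S q -> p <= q,
      size W = p &
      forall n, nim_value S n = nth 0 W (n %% p)].

Local Open Scope classical_set_scope.
Local Open Scope nat_scope.

Definition expansion (S : {fset nat}) : set nat :=
  [set s | 0 < s /\ forall n, nim_value S (n + s) <> nim_value S n].

(* X^{*p} *)
Definition star (X : set nat) (p : nat) : set nat :=
  [set x + m * p | x in X & m in [set: nat]].

(* {u, u+2, u+4, ...} up to v inclusive *)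
Definition by_twos (u v : nat) : set nat :=
  [set u + 2 * i | i in [set i | u + 2 * i <= v]].

(* Main.v *)
(* The letter of the nim-sequence at a residue r < a + b is the parity of r,
   increased by 2 exactly when b <= r.  Modulo a + b, removing b coins is adding
   a and removing a coins is adding b, so both the mex recursion and the
   description of the expansion are case distinctions on parity and on the
   position of r relative to a and b.  No q < a + b is a period: comparison at 0
   forces q to be even and less than b, and then b - q has value 0 but b has
   value 2.  A residue t outside the expansion yields the value 0 at both ends
   from the position 0 if t is even, and from a + b - t if t is odd. *)
Require Import Defs.
From mathcomp Require Import all_boot.
From mathcomp Require Import finmap classical_sets.
From mathcomp Require Import zify.

Set Implicit Arguments.
Unset Strict Implicit.
Unset Printing Implicit Defensive.

Lemma mex_eq (A : {fset nat}) m :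
  m \notin A -> (forall k, k < m -> k \in A) -> mex A = m.
Proof.
move=> mA ltmA; rewrite /mex; case: ex_minnP => k kA mink.
apply/eqP; rewrite eqn_leq mink // leqNgt; apply/negP => /ltmA.
by rewrite (negPf kA).
Qed.

Lemma modnB_lt p n s : s < p -> s <= n ->
  (n - s) %% p = if s <= n %% p then n %% p - s else n %% p + p - s.
Proof.
move=> sp sn; have p0 : 0 < p by exact: leq_ltn_trans sp.
have rp := ltn_pmod n p0; have En := divn_eq n p.
case: leqP => sr.
  rewrite {1}En -addnBA // modnMDl modn_small //; lia.
(* The residue is smaller than [s] but [s <= n], so one [p] can be borrowed from the quotient. *)
have q0 : 0 < n %/ p by case: (n %/ p) En => //; lia.
have -> : n - s = (n %/ p).-1 * p + (n %% p + p - s).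
  by case: (n %/ p) q0 En => // q _ En /=; rewrite mulSn in En; lia.
by rewrite modnMDl modn_small //; lia.
Qed.

Lemma modnD_lt p n s : 0 < p ->
  (n + s) %% p =
    if n %% p + s %% p < p then n %% p + s %% p else n %% p + s %% p - p.
Proof.
move=> p0; rewrite modnD //.
by case: ltnP => _ //=; rewrite ?mul0n ?subn0 ?mul1n.
Qed.

Lemma size_word_pow x m : size (word_pow x m) = m * size x.
Proof. by elim: m => //= m IH; rewrite size_cat IH mulSn. Qed.

Lemma nth_word_pow2 (u v m i : nat) : i < m.*2 ->
  nth 0 (word_pow [:: u; v] m) i = if odd i then v else u.
Proof.
elim: m i => // m IH [|[|i]] //=; rewrite negbK => im.
by apply: IH; rewrite doubleS !ltnS in im.
Qed.

Definition letter (b r : nat) : nat := odd r + (b <= r).*2.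

Section NimSequence.
Variables a b : nat.
Hypotheses (a_odd : odd a) (b_even : ~~ odd b) (ltab : a < b).

Let p := a + b.
Let S : {fset nat} := [fset 1; a; b]%fset.
Let W := word_pow [:: 0; 1] (b./2) ++ word_pow [:: 2; 3] ((a - 1)./2) ++ [:: 2].

Lemma size_nim_word : size W = p.
Proof. by rewrite /W /p !size_cat !size_word_pow /=; lia. Qed.

Lemma nth_nim_word r : r < p -> nth 0 W r = letter b r.
Proof.
rewrite /p /W /letter => rp; have Eb : b./2 * 2 = b by lia.
rewrite nth_cat size_word_pow /= Eb.
case: ltnP => rb; first by rewrite nth_word_pow2; [case: odd | lia].
have Ea : (a - 1)./2 * 2 = a - 1 by lia.
rewrite nth_cat size_word_pow /= Ea; case: ltnP => ra.
  by rewrite nth_word_pow2; [case: ifP; lia | lia].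
(* Only [r = a + b - 1] is left, which is even and at least [b]. *)
have -> : r - b - (a - 1) = 0 by lia.
by rewrite /=; lia.
Qed.

Lemma nim_value_letter n : nim_value S n = letter b (n %% p).
Proof.
have p0 : 0 < p by rewrite /p; lia.
elim/ltn_ind: n => n IH; rewrite nim_valueE.
have rp := ltn_pmod n p0; have rn := leq_mod n p.
have step s : 0 < s < p -> s <= n -> nim_value S (n - s) =
    letter b (if s <= n %% p then n %% p - s else n %% p + p - s).
  by move=> /andP[s0 sp] sn; rewrite IH ?modnB_lt //; lia.
have inS s : (s \in S) = [|| s == 1, s == a | s == b].
  by rewrite !inE orbA.
apply: mex_eq.
  (* No option repeats the value: each move flips the parity of the residue or carries it across
     [b]. With wrap-around, [r < a] goes to [r + b], and 0 goes to [p - 1]. *)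
  apply/negP => /imfsetP[s /=]; rewrite !inE -orbA => /andP[sS /andP[s0 sn]].
  rewrite step //; last by rewrite /p; case/or3P: sS => /eqP ->; lia.
  by rewrite /letter; move: rp; rewrite /p; case/or3P: sS => /eqP ->;
    case: ifP; lia.
have opt s k : s \in S -> 0 < s <= n %% p -> letter b (n %% p - s) = k ->
    k \in [fset nim_value S (n - s) | s in S & 0 < s <= n]%fset.
  move=> sS /andP[s0 sr] <-; apply/imfsetP; exists s => /=.
    by rewrite inE /= sS s0 (leq_trans sr rn).
  by rewrite step ?sr //; lia.
have S1 : 1 \in S by rewrite inS.
have Sa : a \in S by rewrite inS eqxx orbT.
have Sb : b \in S by rewrite inS eqxx !orbT.
move=> k; rewrite {1}/letter; move: rp; rewrite {1}/p => rp.
(* Below [b] only 0 may be missing, for [r] odd, and removing 1 reaches it. From [b] on, removing 1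
   gives 2 when [r] is odd; [r - b] and [r - a] lie below [b] and supply 0 and 1, having the parity
   of [r] and the opposite one. *)
case: (leqP b (n %% p)) => br ltk; last first.
  by apply: (opt 1) => //; rewrite /letter; lia.
have [k2 | k2] := leqP 2 k; first by apply: (opt 1) => //; rewrite /letter; lia.
have [kr | kr] := eqVneq k (odd (n %% p)).
  by apply: (opt b) => //; rewrite /letter; lia.
by apply: (opt a) => //; rewrite /letter; lia.
Qed.

Lemma nim_word_periodic : periodic_with S p W.
Proof.
have p0 : 0 < p by rewrite /p; lia.
split; last 2 first.
- exact: size_nim_word.
- by move=> n; rewrite nim_value_letter nth_nim_word // ltn_pmod.
- by split=> // n; rewrite !nim_value_letter modnDr.
move=> q [q0 qP]; rewrite leqNgt; apply/negP => qp.
have := qP 0; rewrite !nim_value_letter add0n mod0n modn_small // => q_val.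
have qb : q < b by move: q_val; rewrite /letter; lia.
have := qP (b - q); rewrite !nim_value_letter subnK ?(ltnW qb) //.
by rewrite !modn_small /p /letter; lia.
Qed.

Definition expansion_residue t := if odd t then t <= a else b <= t.

Lemma expansionE s : expansion S s <-> expansion_residue (s %% p).
Proof.
have p0 : 0 < p by rewrite /p; lia.
have tp := ltn_pmod s p0; rewrite /expansion /expansion_residue /=.
split=> [[s0 sP] | tP].
  apply: contraT => tN; exfalso; move: tN.
  case: ifP => t_par tN; [apply: (sP (p - s %% p)) | apply: (sP 0)];
    rewrite !nim_value_letter modnD_lt // ?mod0n.
    by rewrite (@modn_small (p - _)) ?subnK ?ltnn ?subnn // /letter;
      move: tp tN t_par; rewrite /p; lia.
  by rewrite add0n tp /letter; lia.
(* [s = 0] is ruled out: its residue is even and less than [b]. *)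
split; first by case: s tp tP => //; rewrite mod0n /=; lia.
(* For [t] odd, the parity flips without wrap-around; with it, [r >= b] goes below [a]. For [t] even
   the roles swap: [r < a] goes to at least [b], or the wrap by the odd [p] flips the parity. *)
move=> n; rewrite !nim_value_letter modnD_lt //.
have := ltn_pmod n p0; move: (n %% p) (s %% p) tp tP => r t.
by rewrite /p /letter; case: ifP => ?; case: ifP; lia.
Qed.

Lemma by_twosE u v x : by_twos u v x <-> [/\ u <= x, x <= v & odd x = odd u].
Proof.
split=> [[i /= iv <-] | [ux xv xu]]; first by split; lia.
by exists ((x - u)./2) => /=; lia.
Qed.

Lemma starE s :
  star (by_twos 1 a `|` by_twos b (b + a - 1))%classic p s <->
  expansion_residue (s %% p).
Proof.
have p0 : 0 < p by rewrite /p; lia.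
(* Both progressions lie below [p], so membership in the star is decided by the residue alone. *)
have XE x : (by_twos 1 a `|` by_twos b (b + a - 1))%classic x <->
    x < p /\ expansion_residue x.
  split=> [[] /by_twosE[]| []]; rewrite /p /expansion_residue.
  - by move=> *; split; [|case: ifP]; lia.
  - by move=> *; split; [|case: ifP]; lia.
  - by case: ifP => *; [left|right]; apply/by_twosE; split; lia.
split=> [[x /XE[xp xP] [m _ <-]] | sP]; first by rewrite addnC modnMDl modn_small.
exists (s %% p); first by apply/XE; rewrite ltn_pmod.
by exists (s %/ p) => //; rewrite addnC -divn_eq.
Qed.

End NimSequence.

Theorem theorem3p1 (a b : nat) (ha : odd a) (hb0 : 0 < b) (hb : ~~ odd b)
    (hab : a < b) :
  periodic_with [fset 1; a; b]%fset (a + b)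
    (word_pow [:: 0; 1] (b./2) ++ word_pow [:: 2; 3] ((a - 1)./2) ++ [:: 2]) /\
  expansion [fset 1; a; b]%fset =
    star (by_twos 1 a `|` by_twos b (b + a - 1))%classic (a + b).
Proof.
split; first exact: nim_word_periodic.
apply/seteqP; split=> s.
  by move=> /(expansionE ha hb hab)/(starE ha hb hab).
by move=> /(starE ha hb hab)/(expansionE ha hb hab).
Qed.
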